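(* Let $\Phi:\mathbb{X}\to\overline{\mathbb{R}}$ be a proper, lower semicontinuous KL function that is bounded from below, let $m\in\mathbb{N}$, and let $\{x^k\}_{k\in\mathbb{N}}\subset\mathbb{X}$ be a bounded sequence with $\Phi(x^0)<\infty$ such that: (a) there is $a>0$ with $\Phi(x^{k+1})+a\|x^{k+1}-x^k\|^2\le\Phi(x^{\ell(k)})$ for all $k\in\mathbb{N}$; (b) for every convergent subsequence $\{x^{\ell(k_j)}\}_{j\in\mathbb{N}}$, $\limsup_{j\to\infty}\Phi(x^{\ell(k_j)})\le\Phi(\lim_{j\to\infty}x^{\ell(k_j)})$; (c) there is $b>0$ with ${\rm dist}(0,\partial\Phi(x^k))\le b\|x^k-x^{k-1}\|$ for all $k\ge1$. Suppose there is a cluster point $x^*$ of $\{x^k\}_{k\in\mathbb{N}}$ for which there exist $\kappa>0$ and $\varepsilon>0$ such that for all $x,y\in\mathbb{B}(x^*,\varepsilon)$ with $\Phi(x)<\Phi(x^* )+\varepsilon$, $\Phi(y)<\Phi(x^* )+\varepsilon$ and ${\rm dist}(0,\partial\Phi(x))+{\rm dist}(0,\partial\Phi(y))<\varepsilon$, $$\Phi(x)-\Phi(y)\le\kappa\big[{\rm dist}(0,\partial\Phi(x))^2+{\rm dist}(0,\partial\Phi(y))\|x-y\|+\|x-y\|^2\big].$$ Then there exist $\tau\in(0,1)$, $\mu>0$ and an integer $\overline{k}>m$ such that for each $k\ge\overline{k}$ and every integer $i$ with $\ell(k-1)+1\le i\le\ell(k)-1$, $$\sqrt{\Phi(x^{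\ell(k)})-\Phi(x^i)}\le\tau\sqrt{a}\,\|x^i-x^{i-1}\|+\mu\sum_{j=i+1}^{\ell(k)}\|x^j-x^{j-1}\|.$$
   Context: $\mathbb{X}$ is a finite-dimensional real inner product space with induced norm $\|\cdot\|$, $\mathbb{B}(x,\varepsilon)$ is the $\varepsilon$-ball centered at $x$, $\overline{\mathbb{R}}=(-\infty,\infty]$, $\mathbb{N}=\{0,1,2,\dots\}$. For $k\in\mathbb{N}$, $\ell(k)$ is the largest index in $\arg\max\{\Phi(x^j): j=\max\{0,k-m\},\dots,k\}$. $\partial$ denotes the limiting (Mordukhovich) subdifferential, and ${\rm dist}(0,\emptyset)=\infty$. KL property: for $\eta\in(0,\infty]$ let $\Upsilon_\eta$ be the family of continuous concave $\varphi:[0,\eta)\to\mathbb{R}_+$ that are continuously differentiable on $(0,\eta)$ with $\varphi'>0$ on $(0,\eta)$ and $\varphi(0)=0$. A proper function $h$ has the KL property at $\overline{x}\in{\rm dom}\,\partial h$ if there exist $\eta\in(0,\infty]$, a neighborhood $\mathcal{U}$ of $\overline{x}$ and $\varphi\in\Upsilon_\eta$ such that $\varphi'(h(x)-h(\overline{x}))\,{\rm dist}(0,\partial h(x))\ge1$ for all $x\in\mathcal{U}$ with $h(\overline{x})<h(x)<h(\overline{x})+\eta$. $h$ is a KL function if it has the KL property at every point of ${\rm dom}\,\partial h$. *)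

(* Defs.v *)
From HB Require Import structures.
From mathcomp Require Import all_boot all_order all_algebra.
From mathcomp Require Import all_classical all_reals all_analysis.

Set Implicit Arguments.
Unset Strict Implicit.
Unset Printing Implicit Defensive.

Import Order.TTheory GRing.Theory Num.Theory.
Import numFieldNormedType.Exports.

Local Open Scope classical_set_scope.
Local Open Scope ring_scope.

#[short(type="normedVectType")]
HB.structure Definition NormedVector (R : numDomainType) :=
  {V of NormedModule R V & Vector R V}.

(* [dot] makes [V] a Euclidean space; its topology and [`|_|] are then the ones
   induced by [dot]. *)
Definition induces_norm (R : realType) (V : normedVectType R)
    (dot : {dot V for idfun}) :=
  forall u : V, `|u| = Num.sqrt (dot u u).

Section variational_analysis.
Context (R : realType) (V : normedVectType R) (dot : {dot V for idfun}).
Implicit Types (h : V -> \bar R) (x : V) (A : set V).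
Local Open Scope ereal_scope.

Definition proper_fun h := (forall x, -oo < h x) /\ (exists x, h x < +oo).

Definition bounded_below h := exists c : R, forall x, c%:E <= h x.

(* [dist_set x set0 = +oo] *)
Definition dist_set x A : \bar R := ereal_inf [set `|x - v|%:E | v in A].

Definition frechet_subdiff h x : set V :=
  [set v | h x \is a fin_num /\
     0 <= limf_einf
            (fun y => (h y - h x - (dot v (y - x))%:E) * (`|y - x|^-1)%:E) x^'].

(* The convergence [h (u n) --> h x] takes place in [\bar R]; the points outside
   the effective domain of [h] have to be excluded separately, since [h (u n)]
   may tend to [+oo]. *)
Definition limiting_subdiff h x : set V :=
  [set v | h x \is a fin_num /\
     exists (u w : nat -> V),
       [/\ u n @[n --> \oo] --> x, h (u n) @[n --> \oo] --> h x,
           forall n, frechet_subdiff h (u n) (w n) &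
           w n @[n --> \oo] --> v]].

(* The class Upsilon_eta; only the values of [phi] on [0, eta) matter. *)
Definition desingularizing (eta : \bar R) (phi : R -> R) :=
  let D := [set s : R | (0 <= s)%R /\ s%:E < eta] in
  [/\ {within D, continuous phi},
      convex_function D (fun s => (- phi s)%R),
      phi 0%R = 0%R,
      forall s, D s -> (0 <= phi s)%R &
      forall s : R, (0 < s)%R -> s%:E < eta ->
        [/\ derivable phi s 1%R, {for s, continuous (derive1 phi)} &
            (0 < derive1 phi s)%R]].

Definition KL_at h xb :=
  exists (eta : \bar R) (U : set V) (phi : R -> R),
    [/\ 0 < eta, nbhs xb U, desingularizing eta phi &
        forall x, U x -> h xb < h x -> h x < h xb + eta ->
          1 <= (derive1 phi (fine (h x - h xb)))%:E
               * dist_set 0%R (limiting_subdiff h x)].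

Definition KL_function h :=
  forall xb, limiting_subdiff h xb !=set0 -> KL_at h xb.

End variational_analysis.

(* The largest index in the argmax of [u] over the window
   {max(0, k - m), ..., k}; [k - m] is the truncated subtraction, and the window
   is nonempty, so that the maximum below is never the one of an empty family. *)
Definition ell (R : realType) (m : nat) (u : nat -> \bar R) (k : nat) : nat :=
  \max_(j < k.+1 | (k - m <= j)%N &&
      [forall i : 'I_k.+1, (k - m <= i)%N ==> (u i <= u j)%E]) j.

(* Main.v *)
Require Import Defs.
From mathcomp Require Import all_boot all_order all_algebra.
From mathcomp Require Import all_classical all_reals all_analysis.
From mathcomp Require Import ring lra zify.

Set Implicit Arguments.
Unset Strict Implicit.
Unset Printing Implicit Defensive.

Import Order.TTheory GRing.Theory Num.Theory.
Import numFieldNormedType.Exports.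

Local Open Scope classical_set_scope.
Local Open Scope ring_scope.

(** Write f k = Phi (x k), F k = f (l k) with l = ell m (Phi o x), and
   p j = |x j - x (j-1)|.  Let i lie strictly between l (k-1) and l k, and let S be
   the length of the path from x i to x (l k).  The growth condition at
   y = x (l k), z = x i together with the subgradient bound gives
   F k - f i <= kappa ((b q)^2 + b (p i) d + d^2), where q = p (l k) and
   d = |x (l k) - x i| are both at most S.  For mu large enough the right-hand
   side is below ((sqrt a / 2) (p i) + mu S)^2 ([growth_square]), which is the
   claim with tau = 1/2.  The difficulty is that the growth condition is local,
   while xs is only a cluster point: it has to be shown that the tail of the
   sequence does not leave a ball around xs ([descent_trapped]).

   Preliminaries.  F is nonincreasing, hence converges to some om.  The limsup
   hypothesis says that om <= Phi at every cluster point of x (l k); since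
   bounded sets are relatively compact, lower semicontinuity then turns
   x (l k) - x (l k - i) --> 0 into f (l k - i) --> om, and the descent inequality
   turns this into p (l k - i) --> 0, so that one can pass from i to i + 1.  Every
   index n equals l (n + m) - i for some i <= m, whence f --> om and p --> 0.
   Moreover Phi xs = om, and 0 is a limiting subgradient at xs, so that the KL
   property is available there.

   Trapping.  Let D k = sqrt (F (k-m-1) - F k).  The descent inequality and the
   bound on F k - f i give p i <= B (D k + S) inside a gap, so by backward
   induction along the gap its whole length is at most C' D k
   ([backward_gap_sum]).  The KL inequality at x (l k), with p (l k) bounded by
   D k / sqrt a and the arithmetic-geometric mean inequality, gives
   D (k+m+1) <= D k / 2 + C (psi k - psi (k+m+1)), where psi k = phi (F k - om) for
   large k.
   Both facts need x (l k) to be close to xs, but as long as it is, the quantity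
   |x (l k) - xs| + 2 C' sum_(j <= m) (D (k-j) / 2 + C psi (k-j)) does not
   increase ([lyapunov_trap]); it is small when x k comes close to xs with k
   large, so x (l k) is close to xs for good.  Consecutive values of l differ by
   at most m + 1 and p --> 0, so the same holds for x k. *)

(** Linear arithmetic on [nat] from the hypotheses on [nat] alone: the boolean
   comparisons of reals are opaque atoms for [lia], which splits cases on them. *)
Ltac nat_lia :=
  repeat match goal with
  | H : ?P |- _ =>
    lazymatch type of P with
    | Prop => lazymatch P with
      | is_true (leq _ _) => fail
      | is_true (andb (leq _ _) (leq _ _)) => fail
      | @eq nat _ _ => fail
      | _ => clear H
      end
    end
  end; lia.

(** * Relative compactness of bounded sets *)

Import VectorInternalTheory.

Lemma r2v_continuous (R : realType) (V : normedVectType R) :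
  continuous (r2v : 'rV[R]_(dim V) -> V).
Proof.
have r2vE (c : 'rV[R]_(dim V)) : r2v c = \sum_i c ord0 i *: r2v (delta_mx ord0 i).
  rewrite {1}(row_sum_delta c) linear_sum; apply: eq_bigr => i _.
  by rewrite linearZ.
rewrite (_ : r2v = fun c => \sum_i c ord0 i *: r2v (delta_mx ord0 i)); last first.
  exact/funext.
apply: (@continuous_big V _ (@GRing.add V)); first exact: add_continuous.
move=> i _ c; apply: cvgZr_tmp; first exact: (nbhs_filter c).
exact: (@coord_continuous _ _ _ ord0 i c).
Qed.

(** A linear bijection from row vectors maps the unit sphere onto a compact set that
   misses 0, hence onto a set at some distance [d] from 0.  This bounds the
   coordinates of a bounded vector, so a bounded set lies in the image of a
   compact one. *)
Lemma bounded_subset_compact (R : realType) (V : normedVectType R) (M : R) :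
  exists2 K : set V, compact K & forall v, `|v| <= M -> K v.
Proof.
pose n := dim V; pose sphere : set 'rV[R]_n := [set c | `|c| = 1].
have sphere_compact : compact sphere.
  apply: bounded_closed_compact.
    by exists 1; split; [exact: num_real|move=> r r1 c /= ->; exact: ltW].
  have -> : sphere = (fun c : 'rV[R]_n => `|c|) @^-1` [set 1 : R] by [].
  apply: closed_comp; last exact: closed_eq.
  by move=> c _; exact: norm_continuous.
have /(compact_closed (@norm_hausdorff _ _)) img_closed :
    compact ((r2v : _ -> V) @` sphere).
  apply: continuous_compact sphere_compact.
  exact/continuous_subspaceT/r2v_continuous.
have /nbhs_ballP[d /= d0 dP] : nbhs (0 : V) (~` (r2v @` sphere)).
  apply: open_nbhs_nbhs; split; first exact: closed_openC.
  move=> [c /= c1]; rewrite -(linear0 (r2v : _ -> V)) => /r2v_inj c0.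
  by move: c1; rewrite c0 /sphere/= normr0 => /eqP; rewrite eq_sym oner_eq0.
have coord_le (c : 'rV[R]_n) : d * `|c| <= `|@r2v R V c|.
  have [->|c0] := eqVneq c 0; first by rewrite normr0 mulr0.
  have nc : 0 < `|c| by rewrite normr_gt0.
  rewrite leNgt; apply/negP => lt_c.
  apply: (dP (@r2v R V (`|c|^-1 *: c))).
    rewrite -ball_normE /= sub0r normrN linearZ /= normrZ ger0_norm ?invr_ge0//.
    by rewrite mulrC ltr_pdivrMr.
  exists (`|c|^-1 *: c) => //=.
  by rewrite /sphere /= normrZ ger0_norm ?invr_ge0// mulVf// gt_eqF.
exists (r2v @` [set c : 'rV[R]_n | `|c| <= M / d]).
  apply: continuous_compact.
    exact/continuous_subspaceT/r2v_continuous.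
  apply: bounded_closed_compact.
    by exists (M / d); split; [exact: num_real|move=> r r1 c /= cM; exact: le_trans cM (ltW r1)].
  have -> : [set c : 'rV[R]_n | `|c| <= M / d] = (fun c : 'rV[R]_n => `|c|) @^-1` [set r : R | r <= M / d] by [].
  apply: closed_comp; last exact: closed_le.
  by move=> c _; exact: norm_continuous.
move=> v vM; exists (v2r v); last exact: v2rK.
rewrite /= ler_pdivlMr// mulrC; apply: le_trans vM.
by rewrite (le_trans (coord_le _))// v2rK.
Qed.

(** * The index of the last maximum over a window *)

Lemma ell_le (R : realType) (m : nat) (u : nat -> \bar R) (k : nat) : (ell m u k <= k)%N.
Proof. by apply/bigmax_leqP => j _; rewrite -ltnS ltn_ord. Qed.

Section Ell.
Context (R : realType) (m : nat) (f : nat -> R).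
Let l := ell m (EFin \o f).

(** [ell] is a maximum over an a priori possibly empty family; all that is used of it
   is that it lies in the window, is an argmax, and is the last one. *)
Lemma ellP k : [/\ (k - m <= l k <= k)%N,
  forall j, (k - m <= j <= k)%N -> f j <= f (l k) &
  forall j, (k - m <= j <= k)%N -> f (l k) <= f j -> (j <= l k)%N].
Proof.
pose P (j : 'I_k.+1) := (k - m <= j)%N &&
      [forall i : 'I_k.+1, (k - m <= i)%N ==> ((EFin \o f) i <= (EFin \o f) j)%E].
have argmax (j : 'I_k.+1) : reflect ((k - m <= j)%N /\
    forall i, (k - m <= i <= k)%N -> f i <= f j) (P j).
  apply: (iffP andP) => -[kj jmax]; split=> //.
    move=> i /andP[ki ik]; have ik' : (i < k.+1)%N by [].
    by have /forallP/(_ (Ordinal ik'))/implyP/(_ ki) := jmax; rewrite /= lee_fin.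
  apply/forallP => i; apply/implyP => ki; rewrite /= lee_fin; apply: jmax.
  by rewrite ki -ltnS ltn_ord.
have [j0 Pj0] : exists j, P j.
  have kk : (k - m <= (ord_max : 'I_k.+1))%N by rewrite /= leq_subr.
  have [j kj jmax] := @Order.TotalTheory.arg_maxP _ _ _ (ord_max : 'I_k.+1)
    (fun j : 'I_k.+1 => (k - m <= j)%N) f kk.
  exists j; apply/argmax; split=> // i /andP[ki ik].
  exact: (jmax (Ordinal (ik : (i < k.+1)%N))).
have [j Pj lj] : {j : 'I_k.+1 | P j & l k = j :> nat}.
  apply: (@eq_bigmax_cond _ P (fun j : 'I_k.+1 => j : nat)).
  by apply/card_gt0P; exists j0.
have /argmax[kj jmax] := Pj; rewrite lj; split=> //.
  by rewrite kj -ltnS ltn_ord.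
move=> i /andP[ki ik] fji; have ik' : (i < k.+1)%N by [].
rewrite -lj /l /ell.
apply: (@leq_bigmax_cond _ P (fun j : 'I_k.+1 => j : nat) (Ordinal ik')).
apply/argmax; split=> //= i' i'k; exact: le_trans (jmax _ i'k) fji.
Qed.

Lemma ell_window k : (k - m <= l k <= k)%N.
Proof. by have [] := ellP k. Qed.

Lemma ell_max k j : (k - m <= j <= k)%N -> f j <= f (l k).
Proof. by have [_ + _] := ellP k; exact. Qed.

Hypothesis desc : forall k, f k.+1 <= f (l k).

Lemma ell_descent k : f (l k.+1) <= f (l k).
Proof.
have /andP[low high] := ell_window k.+1.
have [last|] := eqVneq (l k.+1) k.+1; first by rewrite last desc.
by move=> /eqP notlast; apply: ell_max; lia.
Qed.

(** Either [l k] is still in the next window, and then it cannot be beaten by an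
   earlier index because the maximum did not increase, or it has just left it. *)
Lemma ell_le_succ k : (l k <= l k.+1)%N.
Proof.
have [win _ last] := ellP k.+1; have /andP[wk wk'] := ell_window k.
have [low|out] := leqP (k.+1 - m)%N (l k).
  by apply: last; [rewrite low ltnW|exact: ell_descent].
by move: win => /andP[win _]; rewrite ltnW// (leq_trans out).
Qed.

End Ell.

(** * Subsequences and cluster points *)

Lemma cluster_often (R : realType) (V : normedModType R) (x : nat -> V) (xs : V)
    (e : R) (N : nat) :
  cluster (x n @[n --> \oo]) xs -> 0 < e -> exists2 k, (N <= k)%N & `|x k - xs| < e.
Proof.
move=> xs_cluster e0; have [|z [[n /= Nn <-]]] := xs_cluster
    [set x n | n in [set n | (N <= n)%N]] (ball xs e) _ (nbhsx_ballx _ _ e0).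
  by exists N => // n /= Nn; exists n.
by rewrite -ball_normE /= distrC; exists n.
Qed.

Lemma bounded_recurrent_cluster (R : realType) (V : normedVectType R)
    (x : nat -> V) (M : R) (B : nat -> Prop) :
  (forall n, `|x n| <= M) -> (forall N, exists2 k, (N <= k)%N & B k) ->
  exists xb, forall e : R, 0 < e -> forall N, exists k,
    [/\ (N <= k)%N, B k & `|x k - xb| < e].
Proof.
move=> xM Brec; have [K Kcompact KM] := bounded_subset_compact V M.
have [s sB] := choice (fun N => (exists2P _ _).1 (Brec N)).
have [|xb [_ xb_cluster]] := Kcompact ((x \o s) n @[n --> \oo]) _.
  by exists 0%N => // n _; exact/KM/xM.
exists xb => e e0 N.
have [|z [[n /= Nn <-]]] := xb_cluster [set x (s n) | n in [set n | (N <= n)%N]]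
    (ball xb e) _ (nbhsx_ballx _ _ e0).
  by exists N => // n /= Nn; exists n.
rewrite -ball_normE /= distrC => xsn; exists (s n); have [ns Bs] := sB n.
by split=> //; exact: leq_trans ns.
Qed.

Lemma subsequence_selection (P : nat -> nat -> Prop) :
  (forall n N, exists2 k, (N <= k)%N & P n k) ->
  exists2 s : nat -> nat, increasing_seq s & forall n, P n (s n).
Proof.
move=> Pinf; have [g gP] := choice (fun nN : nat * nat => (exists2P _ _).1 (Pinf nN.1 nN.2)).
pose s := fix s n := if n is n'.+1 then g (n, (s n').+1) else g (0%N, 0%N).
exists s.
  by apply/increasing_seqP => n; rewrite ltEnat; have [] := gP (n.+1, (s n).+1).
by case=> [|n]; [have [] := gP (0%N, 0%N)|have [] := gP (n.+1, (s n).+1)].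
Qed.

(** * Asymptotic behaviour of nonmonotone descent *)

Section Descent.
Context (R : realType) (V : normedVectType R) (Phi : V -> \bar R).
Context (m : nat) (x : nat -> V) (f : nat -> R) (a M c : R).
Let l := ell m (EFin \o f).
Hypothesis Phi_lsc : lower_semicontinuous Phi.
Hypothesis Phi_x : forall k, Phi (x k) = (f k)%:E.
Hypothesis a_gt0 : 0 < a.
Hypothesis x_bounded : forall k, `|x k| <= M.
Hypothesis f_bounded : forall k, c <= f k.
Hypothesis descent : forall k, f k.+1 + a * `|x k.+1 - x k| ^+ 2 <= f (l k).
Hypothesis limsup_le : forall s : nat -> nat, increasing_seq s -> forall xb : V,
  x (l (s j)) @[j --> \oo] --> xb ->
  (limn_esup (fun j => Phi (x (l (s j)))) <= Phi xb)%E.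

Lemma descent_weak k : f k.+1 <= f (l k).
Proof.
by apply: le_trans (descent k); rewrite lerDl mulr_ge0 ?exprn_ge0// ltW.
Qed.

Lemma ell_value_noninc : nonincreasing_seq (f \o l).
Proof. by apply/nonincreasing_seqP => k; exact: ell_descent descent_weak k. Qed.

Lemma ell_value_cvg : (f \o l) k @[k --> \oo] --> inf (range (f \o l)).
Proof.
apply: nonincreasing_cvgn; first exact: ell_value_noninc.
by exists c => _ [k _ <-]; exact: f_bounded.
Qed.

Let om := inf (range (f \o l)).

Lemma ell_value_ge k : om <= f (l k).
Proof.
apply: ge_inf; last by exists k.
by exists c => _ [i _ <-]; exact: f_bounded.
Qed.

Lemma ell_cvg_infty : l k @[k --> \oo] --> \oo.
Proof.
apply/cvgnyPge => N; exists (N + m)%N => // k /= Nk.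
by have /andP[+ _] := ell_window m f k; rewrite -/l; lia.
Qed.

Lemma ell_sub_cvg_infty i : (l k - i)%N @[k --> \oo] --> \oo.
Proof.
apply/cvgnyPge => N; have /cvgnyPge/(_ (N + i)%N) := ell_cvg_infty.
by apply: filterS => k; lia.
Qed.

(** Along a subsequence converging to [xb] the values tend to [om], so that the
   limsup in the hypothesis is [om]. *)
Lemma ell_cluster_value_ge xb :
  (forall e : R, 0 < e -> forall N, exists2 k, (N <= k)%N & `|x (l k) - xb| < e) ->
  (om%:E <= Phi xb)%E.
Proof.
move=> xb_cluster.
have [|s s_incr s_close] := @subsequence_selection
    (fun n k => `|x (l k) - xb| < n.+1%:R^-1).
  by move=> n N; apply: xb_cluster; rewrite invr_gt0.
have s_infty : s j @[j --> \oo] --> \oo.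
  apply/cvgnyPge => N; exists N => // n /= Nn; apply: leq_trans Nn _.
  elim: n => // n sn; apply: leq_ltn_trans sn _.
  exact: (increasing_seqP s).2 s_incr n.
have -> : om%:E = limn_esup (fun j => Phi (x (l (s j)))).
  under eq_fun do rewrite Phi_x.
  apply/esym; apply: (cvg_limn_einf_sup _).2.
  apply: cvg_EFin; first by exact: nearW.
  exact: cvg_comp s_infty ell_value_cvg.
apply: limsup_le => //; apply/cvgrPdist_lt => e e0.
near=> n; rewrite distrC (lt_trans (s_close n))//.
by near: n; exact: near_infty_natSinv_lt (PosNum e0).
Unshelve. all: by end_near. Qed.

(** If the values stayed below [om - e] infinitely often, the corresponding [x (l k)]
   would have a cluster point, at which Phi is at least [om]; this contradicts
   lower semicontinuity, since [x (l k - i)] clusters at the same point. *)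
Lemma shifted_value_cvg i :
  x (l k) - x (l k - i)%N @[k --> \oo] --> (0 : V) ->
  f (l k - i)%N @[k --> \oo] --> om.
Proof.
move=> gap0; apply/cvgrPdist_lt => e e0.
have upper : \forall k \near \oo, f (l k - i)%N < om + e.
  have Fom : \forall k \near \oo, f (l k) < om + e.
    by apply: (cvgr_lt _ ell_value_cvg); rewrite ltrDl.
  have : \forall k \near \oo, f (l (l k - i)%N) < om + e.
    exact: (ell_sub_cvg_infty i Fom).
  by apply: filterS => k; apply: le_lt_trans; apply: ell_max; rewrite leq_subr leqnn.
have lower : \forall k \near \oo, om - e < f (l k - i)%N.
  apply: contrapT => not_ev.
  have often : forall N, exists2 k, (N <= k)%N & f (l k - i)%N <= om - e.
    move=> N; apply: contrapT => none; apply: not_ev; exists N => // k /= Nk.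
    by rewrite ltNge; apply/negP => bad; apply: none; exists k.
  have [xb xb_cluster] := bounded_recurrent_cluster (fun k => x_bounded (l k)) often.
  have om_le : (om%:E <= Phi xb)%E.
    apply: ell_cluster_value_ge => d d0 N.
    by have [k [Nk _ kd]] := xb_cluster d d0 N; exists k.
  have [|U /nbhs_ballP[d /= d0 dU] UPhi] := Phi_lsc (x := xb) (a := om - e).
    by apply: lt_le_trans om_le; rewrite lte_fin ltrBlDr ltrDl.
  have d2 : 0 < d / 2 by rewrite divr_gt0.
  have [N _ gapN] := cvgr0_norm_lt _ gap0 _ d2.
  have [k [Nk fk xk]] := xb_cluster _ d2 N.
  have /UPhi : U (x (l k - i)%N).
    apply: dU; rewrite -ball_normE /= -(subrK (x (l k)) xb) -addrA.
    rewrite (le_lt_trans (ler_normD _ _))// [ltRHS]splitr ltrD ?gapN//.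
    by rewrite distrC.
  by rewrite Phi_x lte_fin ltNge fk.
near=> k; rewrite ltr_distlC; apply/andP; split; near: k; [exact: lower|exact: upper].
Unshelve. all: by end_near. Qed.

(** The convergence of the values at [l k - i] forces the step arriving there to
   vanish, because its square is bounded by a decrease of values that all tend to
   [om]; this step is what separates [l k - i] from [l k - i.+1]. *)
Lemma shifted_gap_cvg i : x (l k) - x (l k - i)%N @[k --> \oo] --> (0 : V).
Proof.
elim: i => [|i gap0].
  by under eq_fun do rewrite subn0 subrr; exact: cvg_cst.
have value := shifted_value_cvg gap0.
apply/cvgrPdist_lt => e e0; have e2 : 0 < e / 2 by rewrite divr_gt0.
have index_ev : \forall k \near \oo, (0 < l k - i)%N.
  exact: ((cvgnyPgt _).1 (ell_sub_cvg_infty i) 0%N).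
have prior_ev : \forall k \near \oo,
    f (l (l k - i.+1)%N) < om + a * (e / 2) ^+ 2 / 2.
  have high : \forall k \near \oo, f (l k) < om + a * (e / 2) ^+ 2 / 2.
    by apply: (cvgr_lt _ ell_value_cvg); rewrite ltrDl !(divr_gt0, mulr_gt0, exprn_gt0).
  exact: (ell_sub_cvg_infty i.+1 high).
have gap_ev : \forall k \near \oo, `|x (l k) - x (l k - i)%N| < e / 2.
  exact: (cvgr0_norm_lt _ gap0 _ e2).
have value_ev : \forall k \near \oo, om - a * (e / 2) ^+ 2 / 2 < f (l k - i)%N.
  by apply: (cvgr_gt _ value); rewrite ltrBlDr ltrDl !(divr_gt0, mulr_gt0, exprn_gt0).
near=> k.
have index_gt : (0 < l k - i)%N by near: k.
have gap : `|x (l k) - x (l k - i)%N| < e / 2 by near: k.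
have low : om - a * (e / 2) ^+ 2 / 2 < f (l k - i)%N by near: k.
have high : f (l (l k - i.+1)%N) < om + a * (e / 2) ^+ 2 / 2 by near: k.
have nextE : (l k - i.+1).+1 = (l k - i)%N by lia.
rewrite sub0r normrN -(subrKA (x (l k - i)%N)) (le_lt_trans (ler_normD _ _))//.
rewrite [ltRHS]splitr ltrD//.
rewrite -(@ltr_pXn2r _ 2)// ?nnegrE ?(ltW e2)// -(ltr_pM2l a_gt0).
have := descent (l k - i.+1)%N; rewrite nextE; lra.
Unshelve. all: by end_near. Qed.

(* transfers what is known at the indices [l k - i] to all indices *)
Let index_shift n : exists i : 'I_m.+1, n = (l (n + m) - i)%N.
Proof.
have /andP[lo hi] := ell_window m f (n + m).
have im : (l (n + m) - n < m.+1)%N by rewrite /l; lia.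
by exists (Ordinal im) => //=; rewrite /l; lia.
Qed.

Lemma descent_value_cvg : f k @[k --> \oo] --> om.
Proof.
apply/cvgrPdist_lt => e e0.
have [N _ fN] : \forall k \near \oo, forall i : 'I_m.+1, `|om - f (l k - i)%N| < e.
  apply: filter_forall => i.
  exact: (cvgrPdist_lt _ _).1 (shifted_value_cvg (shifted_gap_cvg i)) _ e0.
exists N => // n /= Nn; have [i ->] := index_shift n.
by apply: fN; exact: leq_trans (leq_addr _ _).
Qed.

Lemma descent_step_cvg : `|x k - x k.-1| @[k --> \oo] --> 0.
Proof.
apply/cvgrPdist_lt => e e0; have e2 : 0 < e / 2 by rewrite divr_gt0.
(* [m.+2] and not [m.+1]: the index [n.-1] is one step further back *)
have [N _ gapN] : \forall k \near \oo, forall i : 'I_m.+2, `|x (l k) - x (l k - i)%N| < e / 2.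
  by apply: filter_forall => i; exact: cvgr0_norm_lt _ (shifted_gap_cvg i) _ e2.
exists N => // n /= Nn; have [i nE] := index_shift n.
rewrite sub0r normrN normr_id -(subrKA (x (l (n + m)))).
rewrite (le_lt_trans (ler_normD _ _))// [ltRHS]splitr.
have Nnm : (N <= n + m)%N by exact: leq_trans (leq_addr _ _).
have := gapN _ Nnm (widen_ord (leqnSn _) i); rewrite /= -nE distrC => gap1.
have := gapN _ Nnm (lift ord0 i); rewrite lift0 subnS -nE => gap2.
exact: ltrD.
Qed.

Lemma cluster_value xs : cluster (x n @[n --> \oo]) xs -> Phi xs = om%:E.
Proof.
move=> xs_cluster.
apply/eqP; rewrite eq_le; apply/andP; split.
  rewrite leNgt; apply/negP => om_lt.
  have [r om_r r_Phi] : exists2 r, om < r & (r%:E < Phi xs)%E.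
    case: (Phi xs) om_lt => [v| |] //; last by exists (om + 1); rewrite ?ltrDl ?ltry.
    by rewrite lte_fin => omv; exists ((om + v) / 2); rewrite ?lte_fin midf_lt.
  have [U /nbhs_ballP[d /= d0 dU] UPhi] := Phi_lsc r_Phi.
  have [N _ fN] := cvgr_lt _ descent_value_cvg _ om_r.
  have [n Nn xn] := cluster_often N xs_cluster d0.
  have /UPhi : U (x n) by apply: dU; rewrite -ball_normE /= distrC.
  by rewrite Phi_x lte_fin ltNge ltW ?fN.
apply: ell_cluster_value_ge => e e0 N.
have e2 : 0 < e / 2 by rewrite divr_gt0.
have [N1 _ gapN] : \forall k \near \oo, forall i : 'I_m.+1, `|x (l k) - x (l k - i)%N| < e / 2.
  by apply: filter_forall => i; exact: cvgr0_norm_lt _ (shifted_gap_cvg i) _ e2.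
have [n Nn xn] := cluster_often (maxn N N1) xs_cluster e2.
have [i nE] := index_shift n.
exists (n + m)%N; first by lia.
rewrite -(subrKA (x n)) (le_lt_trans (ler_normD _ _))// [ltRHS]splitr ltrD//.
by rewrite {2}nE; apply: gapN => /=; lia.
Qed.

End Descent.

(** * Limiting subgradients and desingularizing functions *)

Lemma dist_set_fin (R : realType) (V : normedVectType R) (A : set V) (v : V) (c : R) :
  (dist_set v A <= c%:E)%E -> exists2 r, dist_set v A = r%:E & 0 <= r <= c.
Proof.
move=> Ac; have A0 : (0 <= dist_set v A)%E.
  by apply: le_ereal_inf_tmp => _ [w _ <-]; rewrite lee_fin.
exists (fine (dist_set v A)).
  by rewrite fineK// fin_numE; case: (dist_set v A) A0 Ac.
by rewrite -!lee_fin fineK ?A0//; case: (dist_set v A) A0 Ac.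
Qed.

Lemma dist_set_lt (R : realType) (V : normedVectType R) (A : set V) (v : V) (e : R) :
  (dist_set v A < e%:E)%E -> exists2 w, A w & `|v - w| < e.
Proof. by move=> /ereal_inf_lt[_ [w Aw <-]]; rewrite lte_fin; exists w. Qed.

(** Limiting subgradients of the approximants are themselves limits of Frechet
   subgradients; a diagonal choice gives Frechet subgradients approximating [w]. *)
Lemma limiting_subdiff_closed (R : realType) (V : normedVectType R)
    (dot : {dot V for idfun}) (h : V -> \bar R) (xb w : V) :
  h xb \is a fin_num ->
  (forall e : R, 0 < e -> exists y v, [/\ limiting_subdiff dot h y v,
     `|y - xb| < e, `|fine (h y) - fine (h xb)| < e & `|v - w| < e]) ->
  limiting_subdiff dot h xb w.
Proof.
move=> hxb approx.
have frechet_approx (n : nat) : exists p : V * V, [/\ frechet_subdiff dot h p.1 p.2,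
    `|p.1 - xb| < n.+1%:R^-1, `|fine (h p.1) - fine (h xb)| < n.+1%:R^-1 &
    `|p.2 - w| < n.+1%:R^-1].
  have e0 : 0 < n.+1%:R^-1 / 2 :> R by rewrite divr_gt0// invr_gt0.
  have [y [v [[hy [u [z [uy huy uz zv]]]] yx hyx vw]]] := approx _ e0.
  have fine_huy : fine (h (u k)) @[k --> \oo] --> fine (h y).
    by apply: fine_cvg; rewrite fineK.
  have uy_ev : \forall k \near \oo, `|u k - y| < n.+1%:R^-1 / 2.
    exact: (cvgr_distC_lt _ _ uy _ e0).
  have fine_huy_ev : \forall k \near \oo, `|fine (h (u k)) - fine (h y)| < n.+1%:R^-1 / 2.
    exact: (cvgr_distC_lt _ _ fine_huy _ e0).
  have zv_ev : \forall k \near \oo, `|z k - v| < n.+1%:R^-1 / 2.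
    exact: (cvgr_distC_lt _ _ zv _ e0).
  near \oo => k; exists (u k, z k); split => //=.
  - rewrite -(subrKA y) (le_lt_trans (ler_normD _ _))// [ltRHS]splitr ltrD//.
    by near: k.
  - rewrite -(subrKA (fine (h y))) (le_lt_trans (ler_normD _ _))//.
    rewrite [ltRHS]splitr ltrD//.
    by near: k.
  - rewrite -(subrKA v) (le_lt_trans (ler_normD _ _))// [ltRHS]splitr ltrD//.
    by near: k.
have [p pP] := choice frechet_approx.
have squeeze (W : normedModType R) (g : nat -> W) (b : W) :
    (forall n, `|g n - b| < n.+1%:R^-1) -> g n @[n --> \oo] --> b.
  move=> gb; apply/cvgrPdist_lt => e e0; near=> n.
  rewrite distrC (lt_trans (gb n))//; near: n.
  exact: near_infty_natSinv_lt (PosNum e0).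
split=> //; exists (fst \o p), (snd \o p); split.
- by apply: squeeze => n; have [] := pP n.
- rewrite -(fineK hxb).
  have -> : (fun n => h ((fst \o p) n)) = (fun n => (fine (h (p n).1))%:E).
    by apply/funext => n; have [[hn _]] := pP n; rewrite fineK.
  apply: cvg_EFin; first exact: nearW.
  by apply: (squeeze R^o) => n; have [] := pP n.
- by move=> n; have [] := pP n.
- by apply: squeeze => n; have [] := pP n.
Unshelve. all: by end_near. Qed.

(** Tangent inequality for a concave function.  The point [t] may be 0, where [phi]
   need not be differentiable, so the secant from [t] to [s] is compared with the
   left difference quotients at [s]. *)
Lemma desingularizing_tangent (R : realType) (eta : \bar R) (phi : R -> R) (s t : R) :
  desingularizing eta phi -> 0 <= t <= s -> 0 < s -> (s%:E < eta)%E ->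
  derive1 phi s * (s - t) <= phi s - phi t.
Proof.
move=> [_ concave _ _ phi_diff] /andP[t0]; rewrite le_eqVlt => /predU1P[->|ts] s0 s_eta.
  by rewrite !subrr mulr0.
have st0 : 0 < s - t by rewrite subr_gt0.
have [phi_s _ _] := phi_diff s s0 s_eta.
rewrite -ler_pdivlMr//.
have quot_cvg : h^-1 *: (phi (h + s) - phi s) @[h --> 0^'] --> derive1 phi s.
  rewrite derive1E; move: phi_s; rewrite /derivable /derive.
  by under eq_fun do rewrite /= [_%:A]mulr1.
apply: (cvgr_to_le (cvg_dnbhs_at_left quot_cvg)).
near=> h.
have h0 : h < 0 by near: h; exact: nbhs_left_lt.
have hst : - (s - t) < h by near: h; apply: nbhs_left_gt; rewrite oppr_lt0.
(* the convex coefficient for which h + s = lam t + (1 - lam) s *)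
pose lam := - h / (s - t).
have lam0 : 0 <= lam by rewrite divr_ge0 ?oppr_ge0 ?(ltW h0) ?(ltW st0).
have lam1 : lam <= 1 by rewrite ler_pdivrMr// mul1r lerNl ltW.
have lamE : lam * (s - t) = - h by rewrite /lam divfK// gt_eqF.
have tD : t \in [set s : R | 0 <= s /\ (s%:E < eta)%E].
  by rewrite inE; split=> //; apply: lt_trans s_eta; rewrite lte_fin.
have sD : s \in [set s : R | 0 <= s /\ (s%:E < eta)%E].
  by rewrite inE; split=> //; exact: ltW.
have : - phi (lam * t + (1 - lam) * s) <= lam * - phi t + (1 - lam) * - phi s.
  exact: concave (Itv01 lam0 lam1) _ _ tD sD.
have -> : lam * t + (1 - lam) * s = h + s by lra.
move=> conc; rewrite /GRing.scale /= mulrC ler_ndivrMr// mulrAC ler_pdivrMr//.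
have -> : (phi s - phi t) * h = - (lam * (phi s - phi t)) * (s - t).
  by rewrite -[h]opprK -lamE; ring.
by rewrite ler_pM2r//; lra.
Unshelve. all: by end_near. Qed.

Lemma desingularizing_cvg0 (R : realType) (eta : \bar R) (phi : R -> R) (g : nat -> R) :
  (0 < eta)%E -> desingularizing eta phi -> (forall k, 0 <= g k) ->
  g k @[k --> \oo] --> 0 -> phi (g k) @[k --> \oo] --> 0.
Proof.
move=> eta0 [/subspace_continuousP phi_cont _ phi0 _ _] g0 g_cvg.
rewrite -[X in _ --> X]phi0.
have below_eta : \forall k \near \oo, ((g k)%:E < eta)%E.
  case: eta eta0 {phi_cont} => [r r0| _|//]; last by near=> k; rewrite ltry.
  have g_r : \forall k \near \oo, g k < r by exact: (cvgr_lt _ g_cvg).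
  by apply: filterS g_r => k; rewrite lte_fin.
have g_within : g k @[k --> \oo] --> within [set s : R | 0 <= s /\ (s%:E < eta)%E] (nbhs 0).
  move=> A /g_cvg gA.
  have ev : \forall k \near \oo, 0 <= g k /\ ((g k)%:E < eta)%E -> A (g k) by exact: gA.
  by apply: filterS2 ev below_eta => k Ak gk; apply: Ak; split; first exact: g0.
exact: cvg_comp g_within (phi_cont 0 (conj (lexx 0) eta0)).
Unshelve. all: by end_near. Qed.

(** How the KL inequality is used: with [c] bounding the distance to the
   subdifferential it gives [1 <= phi' s * c], and the tangent inequality converts a
   decrease of values into a decrease of [phi], at the price of the factor [c]. *)
Lemma desingularized_decrease (R : realType) (eta : \bar R) (phi : R -> R)
    (dist : \bar R) (c s t : R) :
  desingularizing eta phi -> (dist <= c%:E)%E ->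
  (1 <= (derive1 phi s)%:E * dist)%E ->
  0 <= t <= s -> 0 < s -> (s%:E < eta)%E ->
  0 <= phi s - phi t /\ s - t <= c * (phi s - phi t).
Proof.
move=> phiP dist_c KLs /andP[t0 ts] s0 s_eta.
have [_ _ _ _ /(_ s s0 s_eta)[_ _ dphi0]] := phiP.
have tangent : derive1 phi s * (s - t) <= phi s - phi t.
  by apply: desingularizing_tangent phiP _ _ _ => //; rewrite t0.
have st0 : 0 <= s - t by rewrite subr_ge0.
have dphi_c : 1 <= derive1 phi s * c.
  by rewrite -lee_fin EFinM (le_trans KLs)// lee_wpmul2l// lee_fin ltW.
have c0 : 0 < c by rewrite -(pmulr_rgt0 _ dphi0) (lt_le_trans ltr01).
split; first by apply: le_trans tangent; rewrite mulr_ge0// ltW.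
apply: le_trans (ler_wpM2l (ltW c0) tangent).
by rewrite mulrA [c * _]mulrC ler_peMl.
Qed.

(** * Path lengths and the trapping argument *)

(** Adding the term of index [i] to the partial sum from above multiplies
   [D + sum] by at most [1 + B]. *)
Lemma backward_gap_sum (R : realType) (p : nat -> R) (B D : R) (s e : nat) :
  0 <= B -> (s <= e)%N ->
  (forall i, (s < i <= e)%N -> p i <= B * (D + \sum_(i.+1 <= j < e.+1) p j)) ->
  D + \sum_(s.+1 <= j < e.+1) p j <= (1 + B) ^+ (e - s) * D.
Proof.
move=> B0 /subnK; move: (e - s)%N => t; elim: t s => [|t IH] s.
  by move=> <- _; rewrite add0n big_geq// addr0 mul1r.
rewrite addSnnS => tE p_le.
have {}IH : D + \sum_(s.+2 <= j < e.+1) p j <= (1 + B) ^+ t * D.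
  by apply: IH => // i si; apply: p_le; lia.
rewrite big_ltn; last by lia.
have := p_le s.+1 ltac:(lia).
set S := \sum_(_ <= _ < _) _ in IH * => p_s.
rewrite exprS -mulrA (le_trans _ (ler_wpM2l _ IH))//; last by lra.
lra.
Qed.

Lemma path_length_ge (R : realType) (V : normedVectType R) (x : nat -> V) (s e : nat) :
  (s <= e)%N -> `|x e - x s| <= \sum_(s.+1 <= j < e.+1) `|x j - x j.-1|.
Proof.
move=> se; rewrite -(telescope_sumr x se) big_add1 /= big_nat_cond [leRHS]big_nat_cond.
exact: ler_norm_sum.
Qed.

(** With [W k] the sum of [D j / 2 + C * psi j] over the window [k, k + d), the
   contraction hypothesis reads [W k.+1 <= W k - D (k + d) / 2]: the half of
   [D (k + d)] that is not absorbed pays for the next move of [z], so that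
   [`|z (k + d).-1 - xs| + 2 * C' * W k] is nonincreasing.  Both
   hypotheses speak of points near [xs] only, and the bound being propagated is
   what keeps the points there. *)
Lemma lyapunov_trap (R : realType) (V : normedVectType R) (z : nat -> V) (xs : V)
    (d : nat) (D psi : nat -> R) (C C' r : R) (n : nat) :
  (0 < d)%N -> 0 <= C -> 0 <= C' -> (forall k, 0 <= D k) -> (forall k, 0 <= psi k) ->
  (forall k, (n <= k)%N -> `|z k - xs| < r ->
     D (k + d)%N <= D k / 2 + C * (psi k - psi (k + d)%N)) ->
  (forall k, (n <= k)%N -> `|z (k + d).-1 - xs| < r ->
     `|z (k + d)%N - z (k + d).-1| <= C' * D (k + d)%N) ->
  (forall j, (j < d)%N -> `|z (n + j)%N - xs| < r) ->
  `|z (n + d).-1 - xs| + 2 * C' * (\sum_(j < d) (D (n + j)%N / 2 + C * psi (n + j)%N)) < r ->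
  forall k, (n <= k)%N -> `|z k - xs| < r.
Proof.
move=> d0 C0 C'0 D0 psi0 contract progress init init_lyap.
pose W k := \sum_(j < d) (D (k + j)%N / 2 + C * psi (k + j)%N).
have W0 k : 0 <= W k.
  by apply: sumr_ge0 => j _; rewrite addr_ge0 ?divr_ge0 ?mulr_ge0.
have WS k : D k / 2 + C * psi k + W k.+1 = W k + (D (k + d)%N / 2 + C * psi (k + d)%N).
  transitivity (\sum_(j < d.+1) (D (k + j)%N / 2 + C * psi (k + j)%N)).
    rewrite big_ord_recl addn0; congr (_ + _).
    by apply: eq_bigr => j _; rewrite lift0 addSnnS.
  by rewrite big_ord_recr.
have inv t : (forall j, (j < d)%N -> `|z (n + t + j)%N - xs| < r) /\
    `|z (n + t + d).-1 - xs| + 2 * C' * W (n + t)%N < r.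
  elim: t => [|t [win lyap]]; first by rewrite addn0.
  have nt : (n <= n + t)%N by rewrite leq_addr.
  have first_in : `|z (n + t)%N - xs| < r by have := win 0%N d0; rewrite addn0.
  have last_in : `|z (n + t + d).-1 - xs| < r.
    have -> : ((n + t + d).-1 = n + t + d.-1)%N by lia.
    by apply: win; lia.
  have contr := contract _ nt first_in.
  have progr := progress _ nt last_in.
  have new_lyap : `|z (n + t + d)%N - xs| + 2 * C' * W (n + t).+1 < r.
    apply: le_lt_trans lyap.
    rewrite -(subrKA (z (n + t + d).-1)) -lerBrDr (le_trans (ler_normD _ _))//.
    rewrite -lerBrDr (le_trans progr)//.
    have := ler_wpM2l C'0 contr; have := WS (n + t)%N.
    move=> /(congr1 (fun w => 2 * C' * w)).
    lra.
  rewrite addnS; split; last by rewrite addSn.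
  move=> j jd; have [jd1|] := ltnP j.+1 d.
    by rewrite addSnnS; exact: win.
  move=> dj; have -> : ((n + t).+1 + j = n + t + d)%N by lia.
  apply: le_lt_trans new_lyap; rewrite lerDl !mulr_ge0//.
move=> k nk; have [/(_ 0%N d0)] := inv (k - n)%N.
by rewrite addn0 subnKC.
Qed.

(** The three summands of the constant in front of [S] absorb, in the expanded square,
   the term in [p * S] by means of [kappa * b / sqrt a], and the terms in [S ^+ 2] by
   means of [kappa * (b ^+ 2 + 1)]; the summand 1 makes the constant at most its
   square. *)
Lemma growth_square (R : realType) (a b kappa p q d S : R) :
  0 < a -> 0 < b -> 0 < kappa -> 0 <= p -> 0 <= q <= S -> 0 <= d <= S ->
  kappa * ((b * q) ^+ 2 + b * p * d + d ^+ 2)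
    <= (Num.sqrt a / 2 * p
        + (1 + kappa * (b ^+ 2 + 1) + kappa * b / Num.sqrt a) * S) ^+ 2.
Proof.
move=> a0 b0 k0 p0 /andP[q0 qS] /andP[d0 dS].
have s0 : 0 < Num.sqrt a by rewrite sqrtr_gt0.
set s := Num.sqrt a in s0 *; set mu := (X in (_ + X * S) ^+ 2).
have S0 : 0 <= S by apply: le_trans qS.
have e0 : 0 <= kappa * b / s by rewrite divr_ge0// ?mulr_ge0 ?(ltW k0) ?(ltW b0)// ltW.
have g0 : 0 <= kappa * (b ^+ 2 + 1).
  by rewrite mulr_ge0 ?(ltW k0)// addr_ge0// sqr_ge0.
have mu_sqr : kappa * (b ^+ 2 + 1) <= mu ^+ 2.
  by rewrite /mu; set g := kappa * _ in g0 *; set e := kappa * b / s in e0 *; nra.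
have mu_lin : kappa * b <= s * mu.
  rewrite /mu mulrDr [s * (kappa * b / s)]mulrC divfK ?gt_eqF// lerDr.
  by rewrite mulr_ge0 ?(ltW s0)// addr_ge0.
have bS : (b * q) ^+ 2 <= (b * S) ^+ 2.
  by rewrite ler_pXn2r ?nnegrE ?mulr_ge0 ?(ltW b0)// ler_pM2l.
have dS2 : d ^+ 2 <= S ^+ 2 by rewrite ler_pXn2r ?nnegrE.
have pd : b * p * d <= b * p * S by rewrite ler_wpM2l// mulr_ge0// ltW.
apply: (@le_trans _ _ (kappa * ((b * S) ^+ 2 + b * p * S + S ^+ 2))).
  by rewrite ler_pM2l//; lra.
have pS : 0 <= p * S by exact: mulr_ge0.
have t1 : kappa * b * (p * S) <= s * mu * (p * S) by rewrite ler_wpM2r.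
have t2 : kappa * (b ^+ 2 + 1) * S ^+ 2 <= mu ^+ 2 * S ^+ 2 by rewrite ler_wpM2r ?sqr_ge0.
have t3 : 0 <= (s / 2 * p) ^+ 2 by exact: sqr_ge0.
rewrite sqrrD -mulr_natr; lra.
Qed.

Section Trap.
Context (R : realType) (V : normedVectType R).
Context (m : nat) (x : nat -> V) (f : nat -> R) (a b om mu rho : R) (xs : V).
Context (psi : nat -> R).
Context (l : nat -> nat).
Hypothesis l_window : forall k, (k - m <= l k <= k)%N.
Hypothesis l_succ : forall k, (l k <= l k.+1)%N.
Hypothesis value_noninc : nonincreasing_seq (f \o l).
Hypothesis a_gt0 : 0 < a.
Hypothesis b_gt0 : 0 < b.
Hypothesis mu_ge1 : 1 <= mu.
Hypothesis rho_gt0 : 0 < rho.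
Hypothesis descent : forall k, f k.+1 + a * `|x k.+1 - x k| ^+ 2 <= f (l k).
Hypothesis value_cvg : f (l k) @[k --> \oo] --> om.
Hypothesis step_cvg : `|x k - x k.-1| @[k --> \oo] --> 0.
Hypothesis xs_cluster : forall e : R, 0 < e -> forall N,
  exists2 k, (N <= k)%N & `|x k - xs| < e.
Hypothesis psi_ge0 : forall k, 0 <= psi k.
Hypothesis psi_cvg : psi k @[k --> \oo] --> 0.
Hypothesis KL : \forall k \near \oo, `|x (l k) - xs| < rho ->
  forall k', (k <= k')%N -> 0 <= psi k - psi k' /\
    f (l k) - f (l k') <= b * `|x (l k) - x (l k).-1| * (psi k - psi k').
Hypothesis growth : \forall k \near \oo, forall i, (l k.-1 < i < l k)%N ->
  `|x i - xs| < rho -> `|x (l k) - xs| < rho ->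
  f (l k) - f i <= (Num.sqrt a / 2 * `|x i - x i.-1|
    + mu * \sum_(i.+1 <= j < (l k).+1) `|x j - x j.-1|) ^+ 2.

Let F k := f (l k).
Let D k := Num.sqrt (F (k - m.+1)%N - F k).

Let F_noninc k k' : (k <= k')%N -> F k' <= F k.
Proof. exact: value_noninc. Qed.

Let D_ge0 k : 0 <= D k. Proof. exact: sqrtr_ge0. Qed.

Let D_sqr k : D k ^+ 2 = F (k - m.+1)%N - F k.
Proof. by rewrite sqr_sqrtr// subr_ge0 F_noninc// leq_subr. Qed.

Let sqrta_gt0 : 0 < Num.sqrt a. Proof. by rewrite sqrtr_gt0. Qed.

Let D_cvg : D k @[k --> \oo] --> 0.
Proof.
rewrite -(sqrtr0 R) -(subrr om); apply: continuous_cvg; first exact: sqrt_continuous.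
apply: cvgB value_cvg.
have shift_infty : (k - m.+1)%N @[k --> \oo] --> \oo.
  by apply/cvgnyPge => N; exists (N + m.+1)%N => // k /= Nk; nat_lia.
exact: cvg_comp shift_infty value_cvg.
Qed.

Let step_sqr_le k i : (k < i)%N -> a * `|x i - x i.-1| ^+ 2 <= F k - f i.
Proof.
case: i => // i ki; have := descent i; rewrite -/(F i) /=.
have := F_noninc (ki : (k <= i)%N); lra.
Qed.

Let le_of_sqr_le (u v w : R) : 0 <= u -> 0 <= v -> 0 <= w ->
  u ^+ 2 <= v ^+ 2 + w ^+ 2 -> u <= v + w.
Proof.
move=> u0 v0 w0 uvw; rewrite -(@ler_pXn2r _ 2)// ?nnegrE ?addr_ge0//.
by apply: le_trans uvw _; rewrite sqrrD lerD2r lerDl mulrn_wge0// mulr_ge0.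
Qed.

Let value_step_le k : (m < k)%N -> `|x (l k) - x (l k).-1| <= D k / Num.sqrt a.
Proof.
move=> mk; rewrite ler_pdivlMr// -(@ler_pXn2r _ 2)// ?nnegrE ?mulr_ge0//.
rewrite exprMn sqr_sqrtr ?(ltW a_gt0)// mulrC D_sqr.
apply: (@step_sqr_le (k - m.+1)%N (l k)).
by have /andP[+ _] := l_window k; nat_lia.
Qed.

Let contraction k : (m < k)%N ->
    (forall k', (k <= k')%N -> 0 <= psi k - psi k' /\
      F k - F k' <= b * `|x (l k) - x (l k).-1| * (psi k - psi k')) ->
  D (k + m.+1)%N <= D k / 2 + b / Num.sqrt a / 2 * (psi k - psi (k + m.+1)%N).
Proof.
move=> mk /(_ _ (leq_addr m.+1 k))[psi_le F_le].
(* D (k + m + 1)^2 <= D k * y, so the AM-GM inequality applies *)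
set y := b / Num.sqrt a * (psi k - psi (k + m.+1)%N).
have y0 : 0 <= y by rewrite mulr_ge0// divr_ge0 ?ltW.
suff : D (k + m.+1)%N <= (D k + y) / 2 by rewrite /y; lra.
rewrite -(@ler_pXn2r _ 2)// ?nnegrE ?divr_ge0 ?addr_ge0// D_sqr addnK.
apply: (le_trans F_le).
have step := value_step_le mk.
have : b * `|x (l k) - x (l k).-1| * (psi k - psi (k + m.+1)%N) <= D k * y.
  rewrite /y [leRHS](_ : _ = b * (D k / Num.sqrt a) * (psi k - psi (k + m.+1)%N)).
    by rewrite ler_wpM2r// ler_wpM2l// ltW.
  by ring.
have := sqr_ge0 (D k - y); nra.
Qed.

Let B := 2 * mu / Num.sqrt a.
Let C' := (1 + B) ^+ m.+1.

Let B_ge0 : 0 <= B.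
Proof. by rewrite divr_ge0 ?mulr_ge0 ?(le_trans ler01 mu_ge1)// ltW. Qed.

(* The squared step to [i] is bounded by a decrease of values, of which [D K] only
   accounts for the part above [F K]; inside a gap [f i] may lie far below [F K],
   and [gap] bounds the remaining part. *)
Let gap_length_le k (K := (k + m.+1)%N) :
  (forall i, (l K.-1 < i < l K)%N ->
    f (l K) - f i <= (Num.sqrt a / 2 * `|x i - x i.-1|
      + mu * \sum_(i.+1 <= j < (l K).+1) `|x j - x j.-1|) ^+ 2) ->
  \sum_((l K.-1).+1 <= j < (l K).+1) `|x j - x j.-1| <= C' * D K.
Proof.
move=> gap; have K0 : K = K.-1.+1 by rewrite /K addnS.
have se : (l K.-1 <= l K)%N.
  by rewrite [in leqRHS]K0; exact: l_succ.
have /andP[s_lo s_hi] := l_window K.-1; have /andP[e_lo e_hi] := l_window K.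
have p_le i : (l K.-1 < i <= l K)%N ->
    `|x i - x i.-1| <= B * (D K + \sum_(i.+1 <= j < (l K).+1) `|x j - x j.-1|).
  move=> /andP[si ie]; set p := `|x i - x i.-1|; set S := \sum_(_ <= _ < _) _.
  have S0 : 0 <= S by exact: sumr_ge0.
  have p0 : 0 <= p by exact: normr_ge0.
  have ki : (k < i)%N by nat_lia.
  have step := step_sqr_le ki; rewrite -/p in step.
  have DK : D K ^+ 2 = F k - F K by rewrite D_sqr /K addnK.
  have sqrtE : (Num.sqrt a * p) ^+ 2 = a * p ^+ 2 by rewrite exprMn sqr_sqrtr// ltW.
  have : Num.sqrt a * p <= D K + (Num.sqrt a / 2 * p + mu * S).
    apply: le_of_sqr_le => //; first by rewrite mulr_ge0// ltW.
      by rewrite addr_ge0// !mulr_ge0 ?invr_ge0 ?(le_trans ler01 mu_ge1) ?(ltW sqrta_gt0).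
    rewrite sqrtE DK; have [ie'|] := ltnP i (l K).
      by have := gap i ltac:(nat_lia); rewrite -/p -/S -/(F K); lra.
    move=> ei; have iE : i = l K by nat_lia.
    rewrite iE in step; rewrite -/(F K) in step; rewrite (le_trans step)// lerDl sqr_ge0//.
  move=> key; rewrite /B mulrAC ler_pdivlMr//.
  have : D K <= mu * D K by rewrite ler_peMl.
  lra.
have es : (l K - l K.-1 <= m.+1)%N by nat_lia.
have := backward_gap_sum B_ge0 se p_le.
have : (1 + B) ^+ (l K - l K.-1) * D K <= C' * D K.
  by rewrite ler_wpM2r// ler_weXn2l// lerDl.
have := D_ge0 K; lra.
Qed.

Let drift_le (sigma : R) N : (forall j, (N <= j)%N -> `|x j - x j.-1| < sigma) ->
  forall u v, (N <= u)%N -> (u <= v)%N -> `|x v - x u| <= sigma * (v - u)%:R.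
Proof.
move=> small u v Nu uv; apply: le_trans (path_length_ge x uv) _.
rewrite -subSS mulr_natr -[X in _ <= X]sumr_const_nat; apply: ler_sum_nat => j uj.
by apply/ltW/small; nat_lia.
Qed.

(** The radius [rho] is halved so that the path between two consecutive [x (l k)] in
   the ball of radius [r] stays in the ball of radius [rho], where [KL] and
   [growth] apply; [sigma] and [delta] make the initial value of the Lyapunov
   function of [lyapunov_trap] smaller than [r]. *)
Lemma descent_trapped : \forall n \near \oo, `|x n - xs| < rho.
Proof.
pose r := rho / 2; have r0 : 0 < r by rewrite divr_gt0.
have m1 : 0 < m.+1%:R :> R by [].
pose sigma := r / (4 * m.+1%:R).
have sigma0 : 0 < sigma by rewrite divr_gt0// mulr_gt0.
have sigmaE : sigma * m.+1%:R = r / 4 by rewrite /sigma; field; rewrite gt_eqF.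
have C'0 : 0 <= C' by rewrite exprn_ge0// addr_ge0.
pose C := b / Num.sqrt a / 2.
have C0 : 0 <= C by rewrite !divr_ge0// ltW.
have [Np _ small] : \forall j \near \oo, `|x j - x j.-1| < sigma.
  exact: (cvgr_lt _ step_cvg).
pose delta := r / (4 * (C' + 1) * m.+1%:R).
have C'1 : 0 < C' + 1 by rewrite ltr_wpDl.
have delta0 : 0 < delta by rewrite divr_gt0// !mulr_gt0.
have [Nw _ w_small] : \forall k \near \oo, D k / 2 + C * psi k < delta.
  have : D k / 2 + C * psi k @[k --> \oo] --> 0 / 2 + C * 0.
    by apply: cvgD; [exact: cvgMl D_cvg|exact: cvgMr psi_cvg].
  by rewrite mul0r mulr0 addr0 => /cvgr_lt; apply.
have [Nkl _ klP] := KL; have [Ng _ growthP] := growth.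
have nearby u v (e : R) : (Np <= u)%N -> (Np <= v)%N -> (u <= v + m.+1)%N -> (v <= u + m.+1)%N ->
    `|x u - xs| < e -> `|x v - xs| < e + r / 4.
  move=> Nu Nv uv vu xu; rewrite -(subrKA (x u)) addrC (le_lt_trans (ler_normD _ _))//.
  apply: ltr_leD => //; rewrite -sigmaE; have [uv'|vu'] := leqP u v.
    rewrite (le_trans (drift_le small Nu uv'))// ler_pM2l// ler_nat; nat_lia.
  rewrite distrC (le_trans (drift_le small Nv (ltnW vu')))// ler_pM2l// ler_nat; nat_lia.
have [n0 Nn0 xn0] := xs_cluster (divr_gt0 r0 (ltr0n R 4))
  (Np + Nw + Nkl + Ng + 2 * m.+1)%N.
have start j : (j <= m)%N -> `|x (l (n0 + j)) - xs| < r / 2.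
  move=> jm; have /andP[lo hi] := l_window (n0 + j)%N.
  have -> : r / 2 = r / 4 + r / 4 by field.
  by apply: (@nearby n0) => //; nat_lia.
have trapped : forall k, (n0 <= k)%N -> `|x (l k) - xs| < r.
  have r_rho : r < rho by rewrite ltr_pdivrMr// ltr_pMr// ltr1n.
  apply: (@lyapunov_trap R V (fun k => x (l k)) xs m.+1 D psi C C' r) => //.
  - move=> k nk xk; have xk' := lt_trans xk r_rho.
    by apply: contraction; [nat_lia|exact: klP k ltac:(rewrite /=; nat_lia) xk'].
  - move=> k nk; rewrite addnS /= => xk.
    have K0 : (k + m).+1 = (k + m.+1)%N by rewrite addnS.
    have se : (l (k + m) <= l (k + m).+1)%N.
      exact: l_succ.
    rewrite (le_trans (path_length_ge x se))// K0.
    have -> : (k + m)%N = (k + m.+1).-1 by rewrite addnS.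
    apply: gap_length_le => i; rewrite -K0 /= => /andP[si ie].
    have /andP[lo1 hi1] := l_window (k + m)%N.
    have /andP[lo2 hi2] := l_window (k + m).+1.
    have in_rho v : (l (k + m) <= v <= l (k + m).+1)%N -> `|x v - xs| < rho.
      move=> /andP[v1 v2]; have -> : rho = r + r by rewrite /r; field.
      apply: lt_trans (nearby (l (k + m)) v r _ _ _ _ xk) _; try nat_lia.
      by rewrite ltrD2l; lra.
    apply: growthP; rewrite /= ?si//; first nat_lia.
      by apply: in_rho; nat_lia.
    by apply: in_rho; nat_lia.
  - by move=> j jm; apply: lt_trans (start j jm) _; lra.
  - rewrite addnS /=; apply: (@lt_le_trans _ _ (r / 2 + r / 2)); last by lra.
    apply: ltr_leD; first exact: start.
    apply: (@le_trans _ _ (2 * C' * (delta *+ m.+1))).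
      have -> : delta *+ m.+1 = \sum_(j < m.+1) delta by rewrite sumr_const card_ord.
      rewrite ler_wpM2l ?mulr_ge0//.
      by apply: ler_sum => j _; apply/ltW/w_small => /=; nat_lia.
    rewrite -(mulr_natr delta) /delta.
    have -> : 2 * C' * (r / (4 * (C' + 1) * m.+1%:R) * m.+1%:R) = r / 2 * (C' / (C' + 1)).
      by field; rewrite !gt_eqF.
    apply: ler_piMr; first by rewrite divr_ge0// ltW.
    by rewrite ler_pdivrMr// mul1r lerDl.
exists (n0 + m)%N => // n /= n0n; have /andP[lo hi] := l_window n.
have -> : rho = r + r by rewrite /r; field.
apply: lt_trans (nearby (l n) n r _ _ _ _ (trapped n _)) _; try nat_lia.
by rewrite ltrD2l; lra.
Qed.

End Trap.

(** * The estimate inside a gap *)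

Theorem proposition7 (R : realType) (V : normedVectType R)
  (dot : {dot V for idfun}) (hdot : induces_norm dot)
  (Phi : V -> \bar R)
  (Phi_proper : proper_fun Phi)
  (Phi_lsc : lower_semicontinuous Phi)
  (Phi_KL : KL_function dot Phi)
  (Phi_lb : bounded_below Phi)
  (m : nat) (x : nat -> V)
  (x_bounded : bounded_fun x)
  (Phi_x0 : (Phi (x 0%N) < +oo)%E)
  (a : R) (a_gt0 : 0 < a)
  (cond_a : forall k : nat,
    (Phi (x k.+1) + (a * `|x k.+1 - x k| ^+ 2)%:E
       <= Phi (x (ell m (Phi \o x) k)))%E)
  (cond_b : forall s : nat -> nat, increasing_seq s -> forall xb : V,
    x (ell m (Phi \o x) (s j)) @[j --> \oo] --> xb ->
    (limn_esup (fun j : nat => Phi (x (ell m (Phi \o x) (s j)))) <= Phi xb)%E)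
  (cond_c : exists2 b : R, 0 < b & forall k : nat, (1 <= k)%N ->
    (dist_set 0%R (limiting_subdiff dot Phi (x k)) <= (b * `|x k - x k.-1|)%:E)%E)
  (xs : V) (xs_cluster : cluster (x n @[n --> \oo]) xs)
  (growth : exists kappa eps : R, [/\ 0 < kappa, 0 < eps &
    forall y z : V, ball xs eps y -> ball xs eps z ->
      (Phi y < Phi xs + eps%:E)%E -> (Phi z < Phi xs + eps%:E)%E ->
      (dist_set 0%R (limiting_subdiff dot Phi y)
         + dist_set 0%R (limiting_subdiff dot Phi z) < eps%:E)%E ->
      (Phi y - Phi z <= kappa%:E *
         (dist_set 0%R (limiting_subdiff dot Phi y) ^+ 2
          + dist_set 0%R (limiting_subdiff dot Phi z) * `|y - z|%:E
          + (`|y - z| ^+ 2)%:E))%E]) :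
  exists (tau mu : R) (kbar : nat),
    [/\ 0 < tau < 1, 0 < mu, (m < kbar)%N &
      forall k : nat, (kbar <= k)%N -> forall i : nat,
        ((ell m (Phi \o x) k.-1).+1 <= i <= (ell m (Phi \o x) k).-1)%N ->
        (sqrte (Phi (x (ell m (Phi \o x) k)) - Phi (x i))
          <= (tau * Num.sqrt a * `|x i - x i.-1|
              + mu * \sum_(i.+1 <= j < (ell m (Phi \o x) k).+1)
                        `|x j - x j.-1|)%:E)%E].
Proof.
have [Phi_gtNy _] := Phi_proper.
have Phi_x_lt k : (Phi (x k) < +oo)%E.
  elim/ltn_ind: k => -[//|k] IH; apply: le_lt_trans (IH _ (ell_le m (Phi \o x) k)).
  by apply: le_trans (cond_a k); rewrite leeDl// lee_fin mulr_ge0 ?exprn_ge0// ltW.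
pose f k := fine (Phi (x k)).
have Phi_x k : Phi (x k) = (f k)%:E.
  by rewrite fineK// fin_numE gt_eqF ?Phi_gtNy// lt_eqF.
have Phi_xE : Phi \o x = EFin \o f by exact/funext.
rewrite Phi_xE in cond_a cond_b *.
set l := ell m (EFin \o f) in cond_a cond_b *.
have descent k : f k.+1 + a * `|x k.+1 - x k| ^+ 2 <= f (l k).
  by have := cond_a k; rewrite !Phi_x lee_fin.
have [M xM] : exists M, forall k, `|x k| <= M.
  have [M [_ xM]] := x_bounded; exists (M + 1) => k.
  by apply: (xM (M + 1)) => //; rewrite ltrDl.
have [c cf] : exists c, forall k, c <= f k.
  by have [c cPhi] := Phi_lb; exists c => k; rewrite -lee_fin -Phi_x.
have [b b0 dist_le] := cond_c.
pose om := inf (range (f \o l)).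
pose p k := `|x k - x k.-1|.
have om_le k : om <= f (l k) := ell_value_ge m cf k.
have F_noninc : nonincreasing_seq (f \o l) by exact: ell_value_noninc a_gt0 descent.
have F_cvg : f (l k) @[k --> \oo] --> om by exact: ell_value_cvg a_gt0 cf descent.
have f_cvg : f k @[k --> \oo] --> om.
  exact: descent_value_cvg Phi_lsc Phi_x a_gt0 xM cf descent cond_b.
have p_cvg : p k @[k --> \oo] --> 0.
  exact: descent_step_cvg Phi_lsc Phi_x a_gt0 xM cf descent cond_b.
have Phi_xs : Phi xs = om%:E.
  by apply: (cluster_value Phi_lsc Phi_x a_gt0 xM cf descent cond_b).
have xs_critical : limiting_subdiff dot Phi xs 0.
  apply: limiting_subdiff_closed; first by rewrite Phi_xs.
  move=> e e0; have eb0 : 0 < e / b by rewrite divr_gt0.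
  have [N _ evN] : \forall k \near \oo, `|f k - om| < e /\ p k < e / b.
    near=> k; split; near: k; first exact: (cvgr_distC_lt _ _ f_cvg).
    exact: (cvgr_lt _ p_cvg).
  have [k Nk xk] := cluster_often N.+1 xs_cluster e0.
  have [fk pk] := evN k (ltnW Nk).
  have [|v Av ve] := dist_set_lt (A := limiting_subdiff dot Phi (x k)) (v := 0) (e := e).
    apply: le_lt_trans (dist_le k (leq_trans _ Nk)) _ => //.
    by rewrite lte_fin mulrC -ltr_pdivlMr.
  by exists (x k), v; rewrite Phi_x Phi_xs; split=> //; rewrite distrC.
have [kappa [eps [kappa0 eps0 growthP]]] := growth.
pose mu := 1 + kappa * (b ^+ 2 + 1) + kappa * b / Num.sqrt a.
have mu1 : 1 <= mu.
  rewrite /mu -addrA lerDl addr_ge0 ?divr_ge0 ?mulr_ge0 ?(ltW kappa0) ?(ltW b0)//.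
  by rewrite addr_ge0// sqr_ge0.
have [eta [U [phi [eta0 /nbhs_ballP[d /= d0 dU] phiP KLP]]]] := Phi_KL _ (ex_intro _ 0 xs_critical).
pose rho := Num.min d eps.
have rho0 : 0 < rho by rewrite lt_min d0.
have ball_of e v : rho <= e -> `|v - xs| < rho -> ball xs e v.
  by move=> re vr; rewrite -ball_normE /= distrC (lt_le_trans vr).
have rho_d : rho <= d by rewrite ge_min lexx.
have rho_eps : rho <= eps by rewrite ge_min lexx orbT.
(* phi is arbitrary beyond eta; the absolute value makes psi nonnegative for all k *)
pose psi k := `|phi (f (l k) - om)|.
have gap_cvg : f (l k) - om @[k --> \oo] --> 0.
  by rewrite -(subrr om); apply: cvgB F_cvg _; exact: cvg_cst.
have below_eta : \forall k \near \oo, ((f (l k) - om)%:E < eta)%E.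
  case: (eta) eta0 => [r r0| _|//]; last by near=> k; rewrite ltry.
  have gap_r : \forall k \near \oo, f (l k) - om < r by exact: (cvgr_lt _ gap_cvg).
  by apply: filterS gap_r => k; rewrite lte_fin.
have psi_cvg : psi k @[k --> \oo] --> 0.
  rewrite -(normr0 R); apply: cvg_norm.
  by apply: desingularizing_cvg0 eta0 phiP _ gap_cvg => k; rewrite subr_ge0.
have KL_decrease : \forall k \near \oo, `|x (l k) - xs| < rho ->
    forall k', (k <= k')%N -> 0 <= psi k - psi k' /\
      f (l k) - f (l k') <= b * `|x (l k) - x (l k).-1| * (psi k - psi k').
  have [N _ evN] := below_eta.
  exists (N + m.+1)%N => // k /= Nk xk k' kk'.
  have lk_pos : (1 <= l k)%N by have := ell_window m f k; rewrite -/l; nat_lia.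
  have Fk' : f (l k') <= f (l k) by exact: F_noninc.
  have psiE j : (N <= j)%N -> psi j = phi (f (l j) - om).
    move=> Nj; rewrite /psi ger0_norm//; have [_ _ _ phi_ge0 _] := phiP.
    by apply: phi_ge0; split; [rewrite subr_ge0|exact: evN].
  (* at F k = om the KL property says nothing, but then F is constant from k on *)
  have [Fk_eq|Fk_gt] := eqVneq (f (l k)) om.
    have Fk'_eq : f (l k') = om by apply/eqP; rewrite eq_le om_le -Fk_eq Fk'.
    by rewrite /psi Fk_eq Fk'_eq !subrr mulr0.
  have {}Fk_gt : om < f (l k) by rewrite lt_def Fk_gt om_le.
  rewrite !psiE; [|nat_lia..].
  have -> : f (l k) - f (l k') = (f (l k) - om) - (f (l k') - om) by rewrite opprB subrKA.
  have eta_k : ((f (l k) - om)%:E < eta)%E by apply: evN => /=; nat_lia.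
  apply: (desingularized_decrease phiP (dist_le _ lk_pos)) => //.
  - have := KLP (x (l k)); rewrite Phi_xs Phi_x; apply.
    + exact/dU/ball_of.
    + by rewrite lte_fin.
    + by rewrite -lteBlDl// -EFinB.
  - by rewrite lerD2r Fk' andbT subr_ge0.
  - by rewrite subr_gt0.
have gap_growth : \forall k \near \oo, forall i, (l k.-1 < i < l k)%N ->
    `|x i - xs| < rho -> `|x (l k) - xs| < rho ->
    f (l k) - f i <= (Num.sqrt a / 2 * p i
      + mu * \sum_(i.+1 <= j < (l k).+1) p j) ^+ 2.
  have eps2b : 0 < eps / 2 / b by rewrite !divr_gt0.
  have [N _ evN] : \forall k \near \oo, f k < om + eps /\ p k < eps / 2 / b.
    near=> k; split; near: k; last exact: (cvgr_lt _ p_cvg).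
    by apply: (cvgr_lt _ f_cvg); rewrite ltrDl.
  exists (N + m.+2)%N => // k /= Nk i /andP[si ie] xi xk.
  have i_pos : (1 <= i)%N by nat_lia.
  have lk_pos : (1 <= l k)%N by nat_lia.
  have Ni : (N <= i)%N by have := ell_window m f k.-1; rewrite -/l; nat_lia.
  have [fi pi] := evN i Ni; have [fk pk] := evN (l k) (leq_trans Ni (ltnW ie)).
  have [dk dkE /andP[dk0 dkb]] := dist_set_fin (dist_le _ lk_pos).
  have [di diE /andP[di0 dib]] := dist_set_fin (dist_le _ i_pos).
  have small j : p j < eps / 2 / b -> b * p j < eps / 2.
    by move=> pj; rewrite mulrC -ltr_pdivlMr.
  have := growthP (x (l k)) (x i) (ball_of _ _ rho_eps xk) (ball_of _ _ rho_eps xi).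
  rewrite Phi_xs !Phi_x dkE diE -!EFinD !lte_fin => /(_ fk fi).
  rewrite -EFinM -expr2 lee_fin => growth_ki.
  have {}growth_ki := growth_ki ltac:(rewrite [ltRHS]splitr; apply: ltrD;
    [exact: le_lt_trans dkb (small _ pk)|exact: le_lt_trans dib (small _ pi)]).
  apply: le_trans growth_ki _.
  have sum_ge : `|x (l k) - x i| <= \sum_(i.+1 <= j < (l k).+1) p j.
    exact: path_length_ge (ltnW ie).
  have last_le : p (l k) <= \sum_(i.+1 <= j < (l k).+1) p j.
    by rewrite big_nat_recr//= lerDr sumr_ge0// => j _; exact: normr_ge0.
  apply: le_trans (growth_square a_gt0 b0 kappa0 (normr_ge0 _)
    (introT andP (conj (normr_ge0 _) last_le)) (introT andP (conj (normr_ge0 _) sum_ge))).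
  rewrite ler_pM2l// lerD2r lerD// ?ler_wpM2r//.
  by rewrite ler_pXn2r ?nnegrE// mulr_ge0// ltW.
have [N1 _ trapped] : \forall n \near \oo, `|x n - xs| < rho.
  apply: (@descent_trapped R V m x f a b om mu rho xs psi l) => //.
  - exact: ell_window.
  - exact: ell_le_succ (descent_weak a_gt0 descent).
  - by move=> e e0 N; exact: cluster_often.
  - by move=> k; exact: normr_ge0.
have [N2 _ gapP] := gap_growth.
exists (2^-1 : R); exists mu; exists (N1 + N2 + m.+2)%N; split.
- by apply/andP; split; lra.
- exact: (lt_le_trans ltr01 mu1).
- nat_lia.
move=> k Nk i i_gap; have window := ell_window m f k.-1; rewrite -/l in window.
have i_gap' : (l k.-1 < i < l k)%N by nat_lia.
rewrite !Phi_x -EFinB /= lee_fin.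
rewrite [2^-1 * _]mulrC.
have rhs0 : 0 <= Num.sqrt a / 2 * p i + mu * \sum_(i.+1 <= j < (l k).+1) p j.
  apply: addr_ge0; first by rewrite mulr_ge0 ?normr_ge0// divr_ge0 ?sqrtr_ge0.
  apply: mulr_ge0; first exact: le_trans ler01 mu1.
  by apply: sumr_ge0 => j _; exact: normr_ge0.
rewrite -(ger0_norm rhs0) -sqrtr_sqr ler_wsqrtr//.
apply: gapP => //=; first nat_lia.
  by apply: trapped => /=; nat_lia.
by apply: trapped => /=; nat_lia.
Unshelve. all: by end_near. Qed.
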